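(* Let $(\mathbb{X},(-)^\dagger,\iota)$ be an inner product category. Then $\mathbb{X}$ is a unitary category with unitary structure given by $\varphi_A:=\langle 1_A|1_A\rangle:A\to A^\dagger$ for each object $A$.
   Context: Composition is written in diagrammatic order: $fg$ means first $f$, then $g$. An involutive category $(\mathbb{X},(-)^\dagger,\iota)$ is a category $\mathbb{X}$ with a functor $(-)^\dagger:\mathbb{X}^{\mathrm{op}}\to\mathbb{X}$ and a natural isomorphism $\iota_X:X\to X^{\dagger\dagger}$ such that $\iota_{X^\dagger}(\iota_X)^\dagger=1_{X^\dagger}$. A unitary category is an involutive category with a family of isomorphisms $\varphi_X:X\to X^\dagger$, one for each object (not assumed natural), such that [U.1] $\varphi_{X^\dagger}=(\varphi_X^{-1})^\dagger$ and [U.2] $\varphi_X\varphi_{X^\dagger}=\iota_X$. An inner product category is an involutive category with a combinator assigning to each pair $f:A\to X$, $g:B\to X$ a map $\langle f|g\rangle:A\to B^\dagger$ satisfying the axioms below, where for $h:X\to A$, $k:X\to B$ the dual inner product is $\langle h|k\rangle^\iota := \iota_{A^\dagger}\,\langle k^\dagger|h^\dagger\rangle^\dagger\,\iota_B^{-1}:A^\dagger\to B$: [IP.1] $\langle hf|kg\rangle = h\langle f|g\rangle k^\dagger$ for $f:A\to X$, $g:B\to X$, $h:Y\to A$, $k:Z\to B$; [IP.2](a) $\iota_A\langle f^\dagger|g^\dagger\rangle^\iota=\langle f|g\rangle$ and (b) $\iota_B\langle f|g\rangle^\dagger=\langle g|f\rangle$ for $f:A\to X$, $g:B\to X$; [IP.3]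 $\langle f|g\rangle\langle h|k\rangle^\iota = fk$ for $f:A\to X$, $g:B\to X$, $h,k:X\to B$ with $hg=1_X$; [IP.4] $\langle f|g\rangle^\iota\langle h|k\rangle=(kf)^\dagger$ for $f:A\to Z$, $g:A\to X$, $h,k:X\to A$ with $gh=1_A$. *)

(* Defs.v *)
Set Implicit Arguments.
Unset Strict Implicit.
Unset Printing Implicit Defensive.

Declare Scope cat_scope.
Delimit Scope cat_scope with cat.
Open Scope cat_scope.

Record Category := {
  Ob :> Type;
  Hom : Ob -> Ob -> Type;
  idm : forall A, Hom A A;
  comp : forall A B C, Hom A B -> Hom B C -> Hom A C;
  comp_id_l : forall A B (f : Hom A B), comp (idm A) f = f;
  comp_id_r : forall A B (f : Hom A B), comp f (idm B) = f;
  comp_assoc : forall A B C D (f : Hom A B) (g : Hom B C) (h : Hom C D),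
    comp f (comp g h) = comp (comp f g) h
}.

Arguments Hom {_} _ _.
Arguments idm {_} _.
Arguments comp {_ _ _ _} _ _.

Notation "'𝟭' A" := (idm A) (at level 9, A at level 9, format "'𝟭' A") : cat_scope.
(* Diagrammatic order: [f ⋅ g] is first [f], then [g]. *)
Notation "f ⋅ g" := (comp f g) (at level 40, left associativity) : cat_scope.

Definition op (X : Category) : Category := {|
  Ob := Ob X;
  Hom := fun A B => @Hom X B A;
  idm := fun A => @idm X A;
  comp := fun A B C f g => @comp X C B A g f;
  comp_id_l := fun A B f => comp_id_r f;
  comp_id_r := fun A B f => comp_id_l f;
  comp_assoc := fun A B C D f g h => eq_sym (comp_assoc h g f)
|}.

Record Functor (X Y : Category) := {
  fobj :> X -> Y;
  fmap : forall A B : X, Hom A B -> Hom (fobj A) (fobj B);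
  fmap_id : forall A : X, fmap (𝟭 A) = 𝟭 (fobj A);
  fmap_comp : forall (A B C : X) (f : Hom A B) (g : Hom B C),
    fmap (f ⋅ g) = fmap f ⋅ fmap g
}.

Record Iso (X : Category) (A B : X) := {
  iso_hom :> Hom A B;
  iso_inv : Hom B A;
  iso_hom_inv : iso_hom ⋅ iso_inv = 𝟭 A;
  iso_inv_hom : iso_inv ⋅ iso_hom = 𝟭 B
}.

Notation "i ⁻¹" := (iso_inv i) (at level 2, left associativity, format "i ⁻¹") : cat_scope.

Definition dag_ob (X : Category) (F : Functor (op X) X) (A : X) : X := F A.

Definition dag_hom (X : Category) (F : Functor (op X) X) (A B : X)
  (f : @Hom X A B) : @Hom X (dag_ob F B) (dag_ob F A) := @fmap (op X) X F B A f.

Record InvolutiveCategory := {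
  inv_cat :> Category;
  dagger : Functor (op inv_cat) inv_cat;
  iota : forall A : inv_cat, Iso A (dag_ob dagger (dag_ob dagger A));
  iota_natural : forall (A B : inv_cat) (f : Hom A B),
    f ⋅ iota B = iota A ⋅ dag_hom dagger (dag_hom dagger f);
  iota_dagger : forall A : inv_cat,
    iota (dag_ob dagger A) ⋅ dag_hom dagger (iota A) = 𝟭 (dag_ob dagger A)
}.

Arguments iota {_} _.

Notation "A ^†" := (dag_ob (dagger _) A)
  (at level 2, left associativity, format "A ^†") : cat_scope.
Notation "f †" := (dag_hom (dagger _) f)
  (at level 2, left associativity, format "f †") : cat_scope.

Record UnitaryStructure (X : InvolutiveCategory) := {
  phi : forall A : X, Iso A A^†;
  U1 : forall A : X, iso_hom (phi A^†) = ((phi A)⁻¹)†;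
  U2 : forall A : X, phi A ⋅ phi A^† = iota A
}.

Definition InnerProduct (X : InvolutiveCategory) :=
  forall (A B Z : X), Hom A Z -> Hom B Z -> Hom A B^†.

Definition dual_ip (X : InvolutiveCategory) (ip : InnerProduct X)
    (Z A B : X) (h : Hom Z A) (k : Hom Z B) : Hom A^† B :=
  iota A^† ⋅ (ip _ _ _ k† h†)† ⋅ (iota B)⁻¹.

Record InnerProductStructure (X : InvolutiveCategory) := {
  inner :> InnerProduct X;
  IP1 : forall (A B Z Y W : X)
      (f : Hom A Z) (g : Hom B Z) (h : Hom Y A) (k : Hom W B),
    inner (h ⋅ f) (k ⋅ g) = h ⋅ inner f g ⋅ k†;
  IP2a : forall (A B Z : X) (f : Hom A Z) (g : Hom B Z),
    iota A ⋅ dual_ip inner f† g† = inner f g;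
  IP2b : forall (A B Z : X) (f : Hom A Z) (g : Hom B Z),
    iota B ⋅ (inner f g)† = inner g f;
  IP3 : forall (A B Z : X)
      (f : Hom A Z) (g : Hom B Z) (h k : Hom Z B),
    h ⋅ g = 𝟭 Z -> inner f g ⋅ dual_ip inner h k = f ⋅ k;
  IP4 : forall (A Y Z : X)
      (f : Hom A Z) (g : Hom A Y) (h k : Hom Y A),
    g ⋅ h = 𝟭 A -> dual_ip inner f g ⋅ inner h k = (k ⋅ f)†
}.

Notation "⟨ f | g ⟩_ ip" := (@inner _ ip _ _ _ f g)
  (at level 0, f at level 200, g at level 200, ip at level 2,
   format "⟨ f | g ⟩_ ip") : cat_scope.

(* Main.v *)
(* With φ_A := ⟨1|1⟩ and ψ_A its dual inner product, [IP.3] and [IP.4] on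
   identities say that φ_A and ψ_A are mutually inverse.  Unfolding the dual and
   using [IP.2](b) gives ψ_A = φ_{A†} ι_A⁻¹, which is [U.2]; then [IP.2](b) in the
   form ι_A φ_A† = φ_A turns φ_{A†} = ψ_A ι_A into ψ_A†, which is [U.1]. *)
Require Import Defs.

Section Dagger.

Variable X : InvolutiveCategory.

Lemma dag_id (A : X) : (𝟭 A)† = 𝟭 A^†.
Proof. exact (fmap_id (dagger X) A). Qed.

Lemma dag_comp (A B C : X) (f : Hom A B) (g : Hom B C) :
  (f ⋅ g)† = g† ⋅ f†.
Proof. exact (fmap_comp (dagger X) (A := C) (B := B) (C := A) g f). Qed.

End Dagger.

Section InnerProductUnitary.

Variables (X : InvolutiveCategory) (ip : InnerProductStructure X).

Lemma inner_dual_id (A : X) :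
  ⟨ 𝟭 A | 𝟭 A ⟩_ip ⋅ dual_ip ip (𝟭 A) (𝟭 A) = 𝟭 A.
Proof. rewrite IP3, comp_id_l; [reflexivity | apply comp_id_l]. Qed.

Lemma dual_inner_id (A : X) :
  dual_ip ip (𝟭 A) (𝟭 A) ⋅ ⟨ 𝟭 A | 𝟭 A ⟩_ip = 𝟭 A^†.
Proof. rewrite IP4, comp_id_l; [apply dag_id | apply comp_id_l]. Qed.

Definition inner_iso (A : X) : Iso A A^† :=
  {| iso_hom := ⟨ 𝟭 A | 𝟭 A ⟩_ip;
     iso_inv := dual_ip ip (𝟭 A) (𝟭 A);
     iso_hom_inv := inner_dual_id A;
     iso_inv_hom := dual_inner_id A |}.

Lemma inner_iso_inv (A : X) :
  (inner_iso A)⁻¹ = inner_iso A^† ⋅ (iota A)⁻¹.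
(* [IP.2](b) is used at [A^†] with both arguments the identity, so it absorbs the leading [iota]. *)
Proof. simpl; unfold dual_ip; rewrite dag_id, IP2b; reflexivity. Qed.

Lemma inner_iso_dag (A : X) : inner_iso A ⋅ inner_iso A^† = iota A.
Proof.
  (* Padding on the right with [(iota A)⁻¹ ⋅ iota A] exposes the expression for [(inner_iso A)⁻¹],
     which then cancels against [inner_iso A]. *)
  rewrite <- (comp_id_r (inner_iso A^†)), <- (iso_inv_hom (iota A)).
  rewrite (comp_assoc (inner_iso A^†)), <- inner_iso_inv, comp_assoc.
  rewrite iso_hom_inv.
  apply comp_id_l.
Qed.

Lemma inner_iso_dag_inv (A : X) :
  iso_hom (inner_iso A^†) = ((inner_iso A)⁻¹)†.
Proof.
  (* This is [U.2] with [inner_iso A] cancelled on the left. *)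
  assert (E : iso_hom (inner_iso A^†) = (inner_iso A)⁻¹ ⋅ iota A).
  { rewrite <- inner_iso_dag, comp_assoc, iso_inv_hom, comp_id_l.
    reflexivity. }
  assert (H : (inner_iso A)† ⋅ ((inner_iso A)⁻¹)† = 𝟭 A^†^†).
  { rewrite <- dag_comp, iso_inv_hom; apply dag_id. }
  assert (S : iota A ⋅ (inner_iso A)† = inner_iso A) by apply IP2b.
  (* With φ and ψ for [inner_iso A] and its inverse: ψ ι = ψ ι (φ† ψ†) = ψ (ι φ†) ψ† = ψ φ ψ† =
     ψ†. *)
  rewrite E, <- (comp_id_r (iota A)), <- H.
  rewrite (comp_assoc (iota A)), S, comp_assoc, iso_inv_hom.
  apply comp_id_l.
Qed.

End InnerProductUnitary.

Theorem proposition4p6 (X : InvolutiveCategory) (ip : InnerProductStructure X) :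
  exists U : UnitaryStructure X,
    forall A : X, iso_hom (phi U A) = ⟨ 𝟭 A | 𝟭 A ⟩_ip.
Proof.
  exists {| phi := inner_iso X ip;
            U1 := inner_iso_dag_inv X ip;
            U2 := inner_iso_dag X ip |}.
  reflexivity.
Qed.
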